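(* Let $V\subset S_2$ be an $m$-dimensional vector space of quadrics in $n$ variables, represented by a symmetric $n\times n$ matrix $A$ of linear forms in $m$ variables, and let $0\le q\le n-1$. The ideal $I$ generated by $V$ has the property that $\mathfrak m^2\subset I+(\ell_{q+2},\dots,\ell_n)$ for every set of independent linear forms $\ell_{q+2},\dots,\ell_n$ if and only if $A$ is symmetrically $q$-generic.
   Context: $K$ is an algebraically closed field of characteristic not $2$, $S=K[x_1,\dots,x_n]$ is the polynomial ring graded with $\deg x_i=1$, and $\mathfrak m=(x_1,\dots,x_n)$. A quadric is identified with its associated symmetric bilinear form, hence with a symmetric $n\times n$ matrix over $K$. Given a basis $Q_1,\dots,Q_m$ of $V$ with symmetric matrices $A_1,\dots,A_m$, the space $V$ is represented by $A=\sum_i y_iA_i$, a symmetric $n\times n$ matrix of linear forms in the variables $y_1,\dots,y_m$ (setting $y_i=1$ and the other variables $0$ gives the matrix of $Q_i$). A generalized principal $(q+1)\times(q+1)$ submatrix of $A$ is a submatrix of $PAP^*$, where $P$ is an invertible $n\times n$ matrix over $K$ and $P^*$ its transpose, formed by $q+1$ rows and the same $q+1$ columns. The symmetric matrix $A$ is symmetrically $q$-generic if every generalized principal $(q+1)\times(q+1)$ submatrix has linearly independent entries on and above the diagonal. *)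

(* Defs.v *)
From HB Require Import structures.
From mathcomp Require Import all_boot all_order all_algebra.
From mathcomp Require Import mpoly.

Set Implicit Arguments.
Unset Strict Implicit.
Unset Printing Implicit Defensive.

Import GRing.Theory.
Local Open Scope ring_scope.

(* Ideals of a commutative ring as Prop-valued predicates: MathComp's own    *)
(* [idealr] only covers decidable proper ideals.                              *)
Section Ideals.
Variable R : comNzRingType.
Implicit Types (G I J : R -> Prop).

Definition ideal_gen G : R -> Prop := fun f =>
  exists s : seq (R * R),
    (forall p, p \in s -> G p.2) /\ f = \sum_(p <- s) p.1 * p.2.

Definition ideal_add I J : R -> Prop := fun f =>
  exists a b, [/\ I a, J b & f = a + b].

Definition ideal_mul I J : R -> Prop :=
  ideal_gen (fun f => exists a b, [/\ I a, J b & f = a * b]).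

End Ideals.

(* Linear independence of a finite family in a module that need not be       *)
(* finite-dimensional ([free] requires a [vectType]).                         *)
Definition lin_indep (K : fieldType) (M : lmodType K) (J : finType)
    (F : J -> M) : Prop :=
  forall c : J -> K, \sum_j c j *: F j = 0 -> forall j, c j = 0.

Section Quadrics.
Variables (K : fieldType) (n : nat).

Definition irrelevant_ideal : {mpoly K[n]} -> Prop :=
  ideal_gen (fun f => exists i : 'I_n, f = 'X_i).

Definition form_ideal (d : nat) (F : {pred dhomog n K d}) :
    {mpoly K[n]} -> Prop :=
  ideal_gen (fun g => exists2 v, v \in F & g = mpoly_of_dhomog v).

(* The symmetric bilinear form with quad_bil Q u u = Q(u), valid since 2 is   *)
(* invertible wherever it is used.                                            *)
Definition quad_bil (Q : {mpoly K[n]}) (u v : 'rV[K]_n) : K :=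
  (Q.@[(u + v) 0] - Q.@[u 0] - Q.@[v 0]) / 2%:R.

Definition quad_mx (Q : {mpoly K[n]}) : 'M[K]_n :=
  \matrix_(i, j) quad_bil Q (delta_mx 0 i) (delta_mx 0 j).

Definition repr_mx (m : nat) (Q : m.-tuple (dhomog n K 2)) :
    'M[{mpoly K[m]}]_n :=
  \sum_(k < m) 'X_k *: map_mx (@mpolyC m K) (quad_mx (tnth Q k)).

End Quadrics.

Section Genericity.
Variables (K : fieldType) (n m : nat).
Implicit Type A : 'M[{mpoly K[m]}]_n.

(* f enumerates increasingly the chosen rows, which are also the columns.     *)
Definition gen_principal_submx (r : nat) A (B : 'M[{mpoly K[m]}]_r) : Prop :=
  exists (P : 'M[K]_n) (f : 'I_r -> 'I_n),
    [/\ P \in unitmx, {homo f : i j / (i < j)%N} &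
        B = mxsub f f (map_mx (@mpolyC m K) P *m A
                         *m map_mx (@mpolyC m K) P^T)].

Definition upper_entries_indep (r : nat) (B : 'M[{mpoly K[m]}]_r) : Prop :=
  lin_indep (fun p : {p : 'I_r * 'I_r | (p.1 <= p.2)%N} =>
               B (val p).1 (val p).2).

Definition sym_generic (q : nat) A : Prop :=
  forall B : 'M[{mpoly K[m]}]_q.+1,
    gen_principal_submx A B -> upper_entries_indep B.

End Genericity.

(* Main.v *)
Require Import Defs.
From HB Require Import structures.
From mathcomp Require Import all_boot all_order all_algebra.
From mathcomp Require Import mpoly ring zify.

(** Both conditions say that, for every subspace W of dimension q+1 of the
    space of points, every quadratic form on W is the restriction of a quadric
    in V.

    Let T be an invertible matrix, y_k the linear form whose coefficients are
    row k of T, and P the transpose of the inverse of T, so that the rows of P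
    are the basis of the space of points dual to the y_k.  A quadric with
    matrix A is then the sum of the (P A P^T)_ab y_a y_b
    ([homog2_coordsE]).  When the forms l cut out W and span the y_k with k
    outside a set F of q+1 indices, the restriction of the quadric to W is
    read off the principal submatrix of P A P^T on F.  The entries of the
    corresponding submatrix of the representing matrix are the linear forms
    with coefficients (P A_k P^T)_ab, one for each Q_k in the basis; they are
    linearly independent iff no nonzero linear functional on quadratic forms on
    W kills the restrictions of all the Q_k, that is, iff V restricts onto all
    quadratic forms on W.

    If the entries are independent, then linear algebra gives for each pair
    (a, b) in F a quadric of V equal, modulo (l), to y_a y_b or 2 y_a y_b
    ([indep_dual_family]); the products involving any other coordinate lie in
    (l), and the products of coordinates generate the square of the irrelevant
    ideal ([generic_contains_sq]).

    Conversely, a linear relation c between the entries gives the functional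
    sending a polynomial g to the sum of the c_ab (P H P^T)_ab, where H is the
    Hessian of g at the origin.  The Hessian at the origin sees only the
    quadratic part of a polynomial, and it is compatible with multiplication
    ([hess0M]), so this functional kills the whole ideal I + (l), whatever
    the degrees of the cofactors: c is a relation, and the forms l vanish on W.
    As y_a y_b lies in this ideal, c_ab vanishes; on the diagonal the
    functional only gives 2 c_aa ([contains_sq_generic]). *)

Set Implicit Arguments.
Unset Strict Implicit.
Unset Printing Implicit Defensive.

Import GRing.Theory.
Local Open Scope ring_scope.

(** * Ideals *)

Section IdealClosure.
Variable R : comNzRingType.
Implicit Types (G I J : R -> Prop) (a b f g : R).

Definition is_ideal J :=
  [/\ J 0, forall a b, J a -> J b -> J (a + b) & forall a b, J b -> J (a * b)].

(** Induction along a presentation of an element: [S] need not be stable under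
    multiplication, which matters for the kernel of a linear functional. *)
Lemma ideal_gen_ind G (S : R -> Prop) :
  S 0 -> (forall a b, S a -> S b -> S (a + b)) ->
  (forall a g, G g -> S (a * g)) -> forall f, ideal_gen G f -> S f.
Proof.
move=> S0 SD SG f [s [sG ->]]; rewrite big_seq.
by apply: big_ind => // p /sG; apply: SG.
Qed.

Lemma ideal_gen_min G J :
  is_ideal J -> (forall g, G g -> J g) -> forall f, ideal_gen G f -> J f.
Proof.
by case=> J0 JD JM GJ; apply: ideal_gen_ind => // a g /GJ; apply: JM.
Qed.

Lemma ideal_gen_mem G g : G g -> ideal_gen G g.
Proof.
move=> Gg; exists [:: (1, g)]; rewrite big_seq1 mul1r; split=> // p.
by rewrite inE => /eqP->.
Qed.

Lemma ideal_gen_is_ideal G : is_ideal (ideal_gen G).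
Proof.
split=> [|_ _ [s [sG ->]] [t [tG ->]]|a _ [s [sG ->]]].
- by exists [::]; rewrite big_nil.
- exists (s ++ t); rewrite big_cat; split=> // p.
  by rewrite mem_cat => /orP[/sG|/tG].
exists [seq (a * p.1, p.2) | p <- s]; split=> [_ /mapP[p /sG Gp ->] //|].
by rewrite big_map mulr_sumr; apply: eq_bigr => p _; rewrite mulrA.
Qed.

Lemma ideal_add_is_ideal I J :
  is_ideal I -> is_ideal J -> is_ideal (ideal_add I J).
Proof.
case=> I0 ID IM [J0 JD JM]; split.
- by exists 0, 0; rewrite addr0.
- move=> _ _ [a [b [Ia Jb ->]]] [c [d [Ic Jd ->]]].
  by exists (a + c), (b + d); rewrite addrACA; split; auto.
move=> r _ [a [b [Ia Jb ->]]].
by exists (r * a), (r * b); rewrite mulrDr; split; auto.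
Qed.

Lemma ideal_addl I J f : is_ideal J -> I f -> ideal_add I J f.
Proof. by case=> J0 _ _ If; exists f, 0; rewrite addr0. Qed.

Lemma ideal_addr I J f : is_ideal I -> J f -> ideal_add I J f.
Proof. by case=> I0 _ _ Jf; exists 0, f; rewrite add0r. Qed.

Lemma colon_is_ideal J b : is_ideal J -> is_ideal (fun a => J (a * b)).
Proof.
case=> J0 JD JM; split; first by rewrite mul0r.
  by move=> a c Ja Jc; rewrite mulrDl; apply: JD.
by move=> a c Jc; rewrite -mulrA; apply: JM.
Qed.

Lemma ideal_sum J (T : Type) (r : seq T) (S : pred T) (F : T -> R) :
  is_ideal J -> (forall t, S t -> J (F t)) -> J (\sum_(t <- r | S t) F t).
Proof. by case=> J0 JD _ JF; apply: big_ind. Qed.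

End IdealClosure.

Lemma ideal_scale (K : fieldType) (n : nat) (J : {mpoly K[n]} -> Prop) c g :
  is_ideal J -> J g -> J (c *: g).
Proof. by case=> _ _ JM Jg; rewrite -mul_mpolyC; apply: JM. Qed.

Lemma irrelevant_sq_min (K : fieldType) (n : nat) (J : {mpoly K[n]} -> Prop) :
  is_ideal J -> (forall i j, J ('X_i * 'X_j)) ->
  forall f, ideal_mul (@irrelevant_ideal K n) (@irrelevant_ideal K n) f -> J f.
Proof.
move=> idJ JX; apply: ideal_gen_min => // _ [a [b [ma mb ->]]].
(* Each factor is reduced to a variable through the colon ideal by the other. *)
move: ma; apply: (@ideal_gen_min _ _ (fun a => J (a * b))) => [|_ [i ->]].
  exact: colon_is_ideal.
rewrite mulrC; move: mb.
apply: (@ideal_gen_min _ _ (fun b => J (b * _))) => [|_ [j ->]]; last exact: JX.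
exact: colon_is_ideal.
Qed.

(** * Second-order jets at the origin, linear forms and quadrics *)

Section SecondOrder.
Variables (K : fieldType) (n : nat).
Implicit Types (f g : {mpoly K[n]}) (u w : 'rV[K]_n) (c : K).

Definition val0 g : K := g.@[fun=> 0].
Definition grad0 g : 'rV[K]_n := \row_i val0 (mderiv i g).
Definition hess0 g : 'M[K]_n := \matrix_(i, j) val0 (mderiv j (mderiv i g)).
Definition lform u : {mpoly K[n]} := \sum_i u 0 i *: 'X_i.

Lemma val0_is_linear : scalar val0.
Proof. by move=> c f g; rewrite /val0 mevalD mevalZ. Qed.
HB.instance Definition _ :=
  GRing.isLinear.Build K {mpoly K[n]} K *%R val0 val0_is_linear.

Lemma grad0_is_linear : linear grad0.
Proof. by move=> c f g; apply/rowP=> i; rewrite !mxE !linearP. Qed.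
HB.instance Definition _ :=
  GRing.isLinear.Build K {mpoly K[n]} 'rV[K]_n _ grad0 grad0_is_linear.

Lemma hess0_is_linear : linear hess0.
Proof. by move=> c f g; apply/matrixP=> i j; rewrite !mxE !linearP. Qed.
HB.instance Definition _ :=
  GRing.isLinear.Build K {mpoly K[n]} 'M[K]_n _ hess0 hess0_is_linear.

Lemma lform_is_linear : linear lform.
Proof.
move=> c u w; rewrite /lform scaler_sumr -big_split /=.
by apply: eq_bigr => i _; rewrite !mxE scalerDl scalerA.
Qed.
HB.instance Definition _ :=
  GRing.isLinear.Build K 'rV[K]_n {mpoly K[n]} _ lform lform_is_linear.

Lemma val0M f g : val0 (f * g) = val0 f * val0 g.
Proof. exact: mevalM. Qed.

Lemma grad0M f g : grad0 (f * g) = val0 f *: grad0 g + val0 g *: grad0 f.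
Proof.
apply/rowP=> i; rewrite !mxE mderivM linearD /= !val0M addrC.
by congr (_ + _); rewrite mulrC.
Qed.

(** Leibniz rule.  It controls the quadratic part of a product of arbitrary
    polynomials without splitting them into homogeneous components. *)
Lemma hess0M f g :
  hess0 (f * g) = val0 f *: hess0 g + val0 g *: hess0 f
     + ((grad0 f)^T *m grad0 g + (grad0 g)^T *m grad0 f).
Proof.
apply/matrixP=> i j; rewrite !mxE !big_ord1 !mxE.
rewrite mderivM mderivD !mderivM !linearD /= !val0M.
ring.
Qed.

Lemma lform_delta i : lform (delta_mx 0 i) = 'X_i.
Proof.
rewrite /lform (bigD1 i) //= mxE !eqxx scale1r big1 ?addr0 // => j ne_ji.
by rewrite mxE (negPf ne_ji) andbF scale0r.
Qed.

Lemma mderivXU (i j : 'I_n) : mderiv i ('X_j : {mpoly K[n]}) = (i == j)%:R%:MP.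
Proof.
rewrite mderivX mnm1E eq_sym; case: eqP => [->|_]; last by rewrite scale0r.
by rewrite -[X in (X - _)%MM]add0m addmK mpolyX0 scale1r.
Qed.

Lemma val0_lform u : val0 (lform u) = 0.
Proof.
rewrite linear_sum big1 // => i _.
by rewrite linearZ /= /val0 mevalXU mulr0.
Qed.

Lemma grad0_lform u : grad0 (lform u) = u.
Proof.
rewrite linear_sum [RHS]row_sum_delta; apply: eq_bigr => i _.
rewrite linearZ /=; congr (_ *: _); apply/rowP=> j.
by rewrite !mxE mderivXU /val0 mevalC eqxx.
Qed.

Lemma hess0_lform u : hess0 (lform u) = 0.
Proof.
rewrite linear_sum big1 // => i _; rewrite linearZ /=.
apply/matrixP=> j k; rewrite !mxE mderivXU mderivC linear0; exact: mulr0.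
Qed.

Lemma hess0_lformM u w : hess0 (lform u * lform w) = u^T *m w + w^T *m u.
Proof.
by rewrite hess0M !val0_lform !grad0_lform !scale0r !add0r.
Qed.

Lemma lform_homog u : lform u \is 1.-homog.
Proof.
by apply: rpred_sum => i _; apply: rpredZ; rewrite dhomogX; apply/eqP/mdeg1.
Qed.

Lemma homog1_lform g : g \is 1.-homog -> g = lform (grad0 g).
Proof.
move=> /dhomogP hom_g; rewrite {1 2}[g]mpolyE !linear_sum /=.
rewrite big_seq [RHS]big_seq; apply: eq_bigr => m /hom_g/eqP.
rewrite mdeg_eq1 => /existsP[i /eqP->].
by rewrite !linearZ /= -lform_delta grad0_lform.
Qed.

Lemma quad_mx_is_linear : linear (@quad_mx K n).
Proof.
move=> c f g; apply/matrixP=> i j; rewrite !mxE /quad_bil.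
rewrite !mevalD !mevalZ; ring.
Qed.
HB.instance Definition _ :=
  GRing.isLinear.Build K {mpoly K[n]} 'M[K]_n _ (@quad_mx K n) quad_mx_is_linear.

Lemma quad_mx_sym g : (quad_mx g)^T = quad_mx g.
Proof.
apply/matrixP=> i j; rewrite !mxE /quad_bil.
by rewrite [delta_mx 0 j + _]addrC addrAC.
Qed.

Hypothesis char_neq2 : 2%:R != 0 :> K.

Lemma quad_mxXX i j :
  quad_mx ('X_i * 'X_j : {mpoly K[n]})
    = 2%:R^-1 *: (delta_mx i j + delta_mx j i).
Proof.
apply/matrixP=> a b; rewrite !mxE /quad_bil !mevalM !mevalXU !mxE !eqxx /=.
rewrite ![_ == a]eq_sym ![_ == b]eq_sym -!mulnb !natrM.
by field; rewrite char_neq2.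
Qed.

Lemma homog2_ind (S : {mpoly K[n]} -> Prop) :
  S 0 -> (forall f g, S f -> S g -> S (f + g)) ->
  (forall c i j, S (c *: ('X_i * 'X_j))) -> forall g, g \is 2.-homog -> S g.
Proof.
move=> S0 SD SX g /dhomogP hom_g; rewrite [g]mpolyE big_seq.
apply: big_ind => // m /hom_g; rewrite /= => mdeg_m.
have [i m_i]: exists i, m i != 0%N.
  apply/existsP; rewrite -negb_forall; apply/negP=> /forallP m0.
  have m_eq0: m = 0%MM by apply/mnmP=> i; rewrite mnm0E; apply/eqP.
  by move: mdeg_m; rewrite m_eq0 mdeg0.
have le_im: (U_(i) <= m)%MM by rewrite lep1mP.
have /eqP: mdeg (m - U_(i))%MM = 1%N.
  by apply: (@addIn (mdeg U_(i)%MM)); rewrite -mdegD submK // mdeg1.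
rewrite mdeg_eq1 => /existsP[j /eqP m_j].
rewrite -(submK le_im) m_j mpolyXD; exact: SX.
Qed.

(** By linearity it is enough to check this on products of two variables,
    where 2 has to be invertible. *)
Lemma homog2_quad_mx g :
  g \is 2.-homog -> g = \sum_i \sum_j quad_mx g i j *: ('X_i * 'X_j).
Proof.
move: g; apply: homog2_ind => [|f g {1}-> {1}->|c a b].
- by rewrite linear0 big1 // => i _; rewrite big1 // => j _; rewrite mxE scale0r.
- rewrite -big_split; apply: eq_bigr => i _; rewrite -big_split.
  apply: eq_bigr => j _; rewrite /= -scalerDl; congr (_ *: _).
  by rewrite [quad_mx (f + g)]linearD [RHS]mxE.
have sum_delta d e : \sum_i \sum_j (delta_mx d e : 'M[K]_n) i j *: ('X_i * 'X_j)
    = 'X_d * 'X_e :> {mpoly K[n]}.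
  rewrite (bigD1 d) //= (bigD1 e) //= mxE !eqxx scale1r.
  rewrite !big1 ?addr0 // => [i /negPf ne_i|j /negPf ne_j].
    by rewrite big1 // => j _; rewrite mxE ne_i scale0r.
  by rewrite mxE ne_j andbF scale0r.
rewrite linearZ /= quad_mxXX.
transitivity ((c / 2%:R) *: ('X_a * 'X_b + 'X_b * 'X_a : {mpoly K[n]})).
  by rewrite ['X_b * _]mulrC -mulr2n -scaler_nat scalerA divfK.
rewrite -(sum_delta a b) -(sum_delta b a) -big_split scaler_sumr /=.
apply: eq_bigr => i _; rewrite -big_split scaler_sumr.
apply: eq_bigr => j _; rewrite !mxE /= -scalerDl scalerA; congr (_ *: _).
by rewrite mulrA.
Qed.

Lemma hess0_homog2 g : g \is 2.-homog -> hess0 g = quad_mx g *+ 2.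
Proof.
move: g; apply: homog2_ind => [|f g Hf Hg|c i j]; rewrite ?linear0 ?mul0rn //.
  by rewrite !linearD /= Hf Hg mulrnDl.
rewrite !linearZ /= quad_mxXX -!lform_delta hess0_lformM !trmx_delta !mul_delta_mx.
by rewrite -scaler_nat !scalerA mulrAC mulfV // mul1r.
Qed.

Lemma val0_homog2 g : g \is 2.-homog -> val0 g = 0.
Proof.
move: g; apply: homog2_ind => [|f g Hf Hg|c i j]; first by rewrite linear0.
  by rewrite linearD /= Hf Hg addr0.
by rewrite linearZ /= -!lform_delta val0M !val0_lform mul0r mulr0.
Qed.

Lemma grad0_homog2 g : g \is 2.-homog -> grad0 g = 0.
Proof.
move: g; apply: homog2_ind => [|f g Hf Hg|c i j]; first by rewrite linear0.
  by rewrite linearD /= Hf Hg addr0.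
by rewrite linearZ /= -!lform_delta grad0M !val0_lform !scale0r addr0 scaler0.
Qed.

Lemma hess0M_homog1 f g : g \is 1.-homog ->
  hess0 (f * g) = (grad0 f)^T *m grad0 g + (grad0 g)^T *m grad0 f.
Proof.
move=> /homog1_lform ->.
by rewrite hess0M val0_lform hess0_lform scaler0 scale0r !add0r.
Qed.

Lemma hess0M_homog2 f g : g \is 2.-homog ->
  hess0 (f * g) = (val0 f *+ 2) *: quad_mx g.
Proof.
move=> hom_g; rewrite hess0M (val0_homog2 hom_g) (grad0_homog2 hom_g).
rewrite trmx0 mulmx0 mul0mx scale0r !addr0 (hess0_homog2 hom_g).
by rewrite -[RHS]scalerMnl scalerMnr.
Qed.

End SecondOrder.

(** * Change of coordinates *)

(** The linear forms [lform (row k T)] are new coordinates y_k, and the rows of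
    [P] are the basis dual to them. *)
Section Coordinates.
Variables (K : fieldType) (n : nat).
Variables (P T : 'M[K]_n).

Lemma quad_mx_congr_sum (m : nat) (Q : m.-tuple (dhomog n K 2))
    (d : 'I_m -> K) i j :
  (P *m quad_mx (\sum_k d k *: tnth Q k) *m P^T) i j
    = \sum_k d k * (P *m quad_mx (tnth Q k) *m P^T) i j.
Proof.
rewrite linear_sum /= linear_sum /= mulmx_sumr mulmx_suml summxE.
apply: eq_bigr => k _.
by rewrite !linearZ /= -scalemxAl [LHS]mxE.
Qed.

Lemma quad_mx_congr_sym (g : {mpoly K[n]}) i j :
  (P *m quad_mx g *m P^T) i j = (P *m quad_mx g *m P^T) j i.
Proof.
transitivity ((P *m quad_mx g *m P^T)^T j i); first by rewrite [RHS]mxE.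
congr (fun_of_matrix _ j i).
by rewrite !trmx_mul trmxK quad_mx_sym mulmxA.
Qed.

Section Expansion.
Hypothesis PT : P^T *m T = 1%:M.

Lemma lform_coordsE i : 'X_i = \sum_k P k i *: lform (row k T).
Proof.
rewrite -lform_delta; under eq_bigr do rewrite -linearZ /=.
rewrite -linear_sum /=; congr (lform _).
have <- : (delta_mx 0 i : 'rV[K]_n) *m (P^T *m T) = delta_mx 0 i.
  by rewrite PT mulmx1.
rewrite mulmxA mulmx_sum_row; apply: eq_bigr => k _.
by rewrite -rowE !mxE.
Qed.

Lemma homog2_coordsE (char_neq2 : 2%:R != 0 :> K) g : g \is 2.-homog ->
  g = \sum_a \sum_b (P *m quad_mx g *m P^T) a b
          *: (lform (row a T) * lform (row b T)).
Proof.
move=> /(homog2_quad_mx char_neq2) {1}->; move: (quad_mx g) => A.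
under eq_bigr do under eq_bigr do
  rewrite (lform_coordsE _) [X in _ * X](lform_coordsE _) mulr_suml scaler_sumr.
under eq_bigr do rewrite exchange_big /=.
rewrite exchange_big /=; apply: eq_bigr => a _.
under eq_bigr do under eq_bigr do rewrite mulr_sumr scaler_sumr.
under eq_bigr do rewrite exchange_big /=.
rewrite exchange_big /=; apply: eq_bigr => b _.
rewrite mxE scaler_suml exchange_big /=; apply: eq_bigr => j _.
rewrite !mxE mulr_suml scaler_suml; apply: eq_bigr => i _.
rewrite -scalerAl -scalerAr !scalerA; congr (_ *: _); ring.
Qed.

Lemma ideal_coords_sq (J : {mpoly K[n]} -> Prop) :
  is_ideal J ->
  (forall a b, J (lform (row a T) * lform (row b T))) ->
  forall i j, J ('X_i * 'X_j).
Proof.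
move=> idJ Jab i j; rewrite (lform_coordsE i) (lform_coordsE j).
rewrite mulr_suml; apply: ideal_sum => // a _.
rewrite mulr_sumr; apply: ideal_sum => // b _.
by rewrite -scalerAl -scalerAr; do 2!apply: ideal_scale => //.
Qed.

End Expansion.

Section HessianInCoordinates.
Hypothesis TP : T *m P^T = 1%:M.

Lemma row_dual k : row k T *m P^T = delta_mx 0 k.
Proof. by rewrite -row_mul TP rowE mulmx1. Qed.

Lemma tr_row_dual k : P *m (row k T)^T = delta_mx k 0.
Proof. by rewrite -[P]trmxK -trmx_mul row_dual trmx_delta. Qed.

Lemma hess0_coordsM k k' :
  P *m hess0 (lform (row k T) * lform (row k' T)) *m P^T
    = delta_mx k k' + delta_mx k' k.
Proof.
rewrite hess0_lformM mulmxDr mulmxDl !mulmxA -!(mulmxA _ _ P^T).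
by rewrite !row_dual !tr_row_dual !mul_delta_mx.
Qed.

(** On the subspace where y_k vanishes, the quadratic part of a multiple of y_k
    restricts to zero. *)
Lemma hess0M_coords f k i j : k != i -> k != j ->
  (P *m hess0 (f * lform (row k T)) *m P^T) i j = 0.
Proof.
move=> /negPf ne_ki /negPf ne_kj.
rewrite hess0M_homog1 ?lform_homog // grad0_lform.
rewrite mulmxDr mulmxDl !mulmxA tr_row_dual -!(mulmxA _ _ P^T) row_dual.
rewrite mxE; do 2!rewrite [(_ *m _) i j]mxE big_ord1 [delta_mx _ _ _ _]mxE.
by rewrite [j == k]eq_sym [i == k]eq_sym ne_kj ne_ki mulr0 mul0r addr0.
Qed.

End HessianInCoordinates.

End Coordinates.

(** * Independence of the entries of a principal submatrix *)

Section EntriesIndependence.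
Variables (K : fieldType).

(** The matrix [M] has independent rows, hence a right inverse, and the columns
    of the latter are the families [d]. *)
Lemma indep_dual_family (J : finType) (m : nat) (M : J -> 'I_m -> K) :
  (forall c : J -> K, (forall k, \sum_j c j * M j k = 0) -> forall j, c j = 0) ->
  forall j0, exists d : 'I_m -> K,
    forall j, \sum_k d k * M j k = (j == j0)%:R.
Proof.
move=> indepM j0; pose C := \matrix_(i < #|J|, k < m) M (enum_val i) k.
have freeC : row_free C.
  apply: inj_row_free => v vC0.
  suff v0 j : v 0 (enum_rank j) = 0.
    by apply/rowP=> i; rewrite mxE -[i]enum_valK v0.
  move: j; apply: indepM => k.
  have /rowP/(_ k) := vC0; rewrite !mxE => vCk; rewrite -[RHS]vCk.
  rewrite [LHS](reindex _ (onW_bij _ (@enum_val_bij J))) /=.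
  by apply: eq_bigr => i _; rewrite mxE enum_valK.
exists (fun k => pinvmx C k (enum_rank j0)) => j.
have /matrixP/(_ (enum_rank j) (enum_rank j0)) := mulmxVp freeC.
rewrite [LHS]mxE [RHS]mxE (inj_eq enum_rank_inj) => <-.
by apply: eq_bigr => k _; rewrite [C _ _]mxE enum_rankK mulrC.
Qed.

Lemma sum_lin_mpolyX_eq0 (m : nat) (a : 'I_m -> K) :
  \sum_k a k *: 'X_k = 0 :> {mpoly K[m]} <-> forall k, a k = 0.
Proof.
split=> [a0 k|a0]; last by rewrite big1 // => k _; rewrite a0 scale0r.
have := congr1 (mcoeff U_(k)%MM) a0; rewrite mcoeff0 raddf_sum /=.
rewrite (bigD1 k) //= mcoeffZ mcoeffXU eqxx mulr1 big1 ?addr0 // => j ne_jk.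
by rewrite mcoeffZ mcoeffXU (negPf ne_jk) mulr0.
Qed.

Variables (n m : nat) (Q : m.-tuple (dhomog n K 2)).

Lemma repr_mx_congr (P : 'M[K]_n) i j :
  (map_mx (@mpolyC m K) P *m repr_mx Q *m map_mx (@mpolyC m K) P^T) i j
    = \sum_k (P *m quad_mx (tnth Q k) *m P^T) i j *: 'X_k.
Proof.
rewrite /repr_mx mulmx_sumr mulmx_suml summxE; apply: eq_bigr => k _.
by rewrite -scalemxAr -scalemxAl -!map_mxM !mxE mulrC mul_mpolyC.
Qed.

Lemma upper_entries_indepE (r : nat) (P : 'M[K]_n) (f : 'I_r -> 'I_n) :
  upper_entries_indep (mxsub f f (map_mx (@mpolyC m K) P *m repr_mx Q
                                   *m map_mx (@mpolyC m K) P^T)) <->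
  forall c : {p : 'I_r * 'I_r | (p.1 <= p.2)%N} -> K,
    (forall k, \sum_p c p * (P *m quad_mx (tnth Q k) *m P^T)
                              (f (val p).1) (f (val p).2) = 0) ->
    forall p, c p = 0.
Proof.
have sumE (c : {p : 'I_r * 'I_r | (p.1 <= p.2)%N} -> K) :
  \sum_p c p *: (mxsub f f (map_mx (@mpolyC m K) P *m repr_mx Q
                    *m map_mx (@mpolyC m K) P^T)) (val p).1 (val p).2
  = \sum_k (\sum_p c p * (P *m quad_mx (tnth Q k) *m P^T)
                              (f (val p).1) (f (val p).2)) *: 'X_k.
  under eq_bigr do rewrite mxE repr_mx_congr scaler_sumr.
  rewrite exchange_big; apply: eq_bigr => k _; rewrite scaler_suml.
  by apply: eq_bigr => p _; rewrite scalerA.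
split=> indep c c0; apply: indep.
  by rewrite sumE; apply/sum_lin_mpolyX_eq0.
by apply/sum_lin_mpolyX_eq0; rewrite -sumE.
Qed.

End EntriesIndependence.

(** * Genericity gives the inclusion *)

(** If all terms of an element of [J] but the two at (a, b) and (b, a) lie in
    [J], so does the value [h] that these two share: off the diagonal it is
    counted twice, hence the restriction on the characteristic. *)
Lemma ideal_isolate (K : fieldType) (n : nat) (char_neq2 : 2%:R != 0 :> K)
    (J : {mpoly K[n]} -> Prop) (F : 'I_n -> 'I_n -> {mpoly K[n]})
    (g h : {mpoly K[n]}) a b :
  is_ideal J -> J g -> g = \sum_i \sum_j F i j -> F a b = h -> F b a = h ->
  (forall i j, (i, j) != (a, b) -> (i, j) != (b, a) -> J (F i j)) -> J h.
Proof.
move=> idJ Jg; rewrite pair_big (bigD1 (a, b)) //= => def_g Fab Fba JF.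
have [_ JD JM] := idJ.
have Jsub x y : J (x + y) -> J y -> J x.
  move=> Jxy Jy; rewrite -(addrK y x); apply: JD => //.
  by rewrite -mulN1r; apply: JM.
have [eq_ab|ne_ab] := eqVneq a b.
  move: Jg; rewrite def_g Fab => /Jsub; apply; apply: ideal_sum => // -[i j] /=.
  by move=> ne; apply: JF; rewrite // -?eq_ab // {2}eq_ab.
move: Jg; rewrite def_g (bigD1 (b, a)) /=; last first.
  by rewrite xpair_eqE eq_sym (negPf ne_ab).
rewrite Fab Fba addrA => /Jsub J2h.
have {}J2h: J (h + h).
  apply: J2h; apply: ideal_sum => // -[i j] /= /andP[]; exact: JF.
have -> : h = 2%:R^-1 *: (h + h).
  by rewrite -mulr2n -scaler_nat scalerA mulVf // scale1r.
exact: ideal_scale.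
Qed.

Section Sufficiency.
Variables (K : fieldType) (n m q : nat).
Hypothesis (char_neq2 : 2%:R != 0 :> K) (le_q_n : (q <= n)%N).
Variables (V : {vspace dhomog n.+1 K 2}) (Q : m.-tuple (dhomog n.+1 K 2)).
Hypothesis defV : <<Q>>%VS = V.
Variable l : (n - q).-tuple (dhomog n.+1 K 1).

Local Notation J := (ideal_add (form_ideal (mem V)) (form_ideal (mem l))).

Let idJ : is_ideal J.
Proof. by apply: ideal_add_is_ideal; apply: ideal_gen_is_ideal. Qed.

Let J_V v : v \in V -> J (mpoly_of_dhomog v).
Proof.
move=> Vv; apply: ideal_addl; first exact: ideal_gen_is_ideal.
by apply: ideal_gen_mem; exists v.
Qed.

Let J_l i : J (mpoly_of_dhomog (tnth l i)).
Proof.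
apply: ideal_addr; first exact: ideal_gen_is_ideal.
by apply: ideal_gen_mem; exists (tnth l i) => //; apply: mem_tnth.
Qed.

Definition coef_mx : 'M[K]_(n - q, n.+1) := \matrix_i grad0 (tnth l i).

Lemma coef_mx_free : free l -> row_free coef_mx.
Proof.
move=> free_l; apply: inj_row_free => v.
rewrite mulmx_sum_row => v0; apply/rowP=> i; rewrite mxE.
move/freeP: free_l; apply; apply: val_inj; rewrite /= linear_sum /=.
transitivity (lform (\sum_i v 0 i *: row i coef_mx)); last by rewrite v0 linear0.
rewrite linear_sum; apply: eq_bigr => j _; rewrite /= !linearZ /= rowK.
rewrite (tnth_nth 0); congr (_ *: _); apply: homog1_lform.
exact: dhomog_is_dhomog.
Qed.

Lemma ideal_add_row_span u : (u <= coef_mx)%MS -> J (lform u).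
Proof.
case/submxP=> D ->; rewrite mulmx_sum_row linear_sum.
apply: ideal_sum => // i _; rewrite linearZ; apply: ideal_scale => //.
rewrite /= rowK -homog1_lform; first exact: J_l.
exact: dhomog_is_dhomog.
Qed.

(** When [l] is free, the first n - q rows of [T] span the forms [l], and the
    others complete them to a system of coordinates. *)
Let T : 'M[K]_n.+1 := row_ebase coef_mx.

Lemma ideal_add_row_ebase (a : 'I_n.+1) :
  free l -> (a < n - q)%N -> J (lform (row a T)).
Proof.
move=> /coef_mx_free/eqP rankl lt_a; apply: ideal_add_row_span.
have lt_a' : (a < \rank coef_mx)%N by rewrite rankl.
rewrite -(eq_row_base coef_mx); apply: (@eq_row_sub _ _ _ _ _ (Ordinal lt_a')).
rewrite row_mul [RHS]rowE; congr (_ *m _); apply/rowP=> j; rewrite !mxE eqxx /=.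
by rewrite lt_a' andbT eq_sym.
Qed.

(** The last q + 1 coordinates restrict to coordinates on the subspace cut out
    by [l]; the principal submatrix on these indices is the one to which
    genericity is applied. *)
Lemma generic_contains_sq : free l -> sym_generic q (repr_mx Q) ->
  forall f, ideal_mul (@irrelevant_ideal K n.+1) (@irrelevant_ideal K n.+1) f ->
  J f.
Proof.
move=> free_l genQ; have Tunit : T \in unitmx by apply: row_ebase_unit.
pose P := (invmx T)^T; have Punit : P \in unitmx by rewrite unitmx_tr unitmx_inv.
have PT : P^T *m T = 1%:M by rewrite trmxK mulVmx.
apply: irrelevant_sq_min => //; apply: (ideal_coords_sq PT idJ) => a b.
pose y i := lform (row i T).
have Jy (i j : 'I_n.+1) : (i < n - q)%N || (j < n - q)%N -> J (y i * y j).
  case: idJ => _ _ JM; case/orP=> /(ideal_add_row_ebase free_l) Jy; last exact: JM.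
  by rewrite mulrC; apply: JM.
have [|] := boolP ((a < n - q)%N || (b < n - q)%N); first exact: Jy.
rewrite negb_or -!leqNgt => /andP[le_a le_b].
have lt_f (i : 'I_q.+1) : (n - q + i < n.+1)%N.
  by have := ltn_ord i; lia.
pose f i := Ordinal (lt_f i).
have f_incr : {homo f : i j / (i < j)%N} by move=> i j; rewrite /= ltn_add2l.
have f_onto (i : 'I_n.+1) : (n - q <= i)%N -> exists i', f i' = i.
  move=> le_i; have lt_i : (i - (n - q) < q.+1)%N.
    by have := ltn_ord i; lia.
  by exists (Ordinal lt_i); apply: val_inj; rewrite /= subnKC.
(* Only the entries on and above the diagonal are indexed. *)
wlog le_ab : a b le_a le_b / (a <= b)%N => [IH|].
  by case/orP: (leq_total a b); [|rewrite mulrC]; apply: IH.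
have [a' fa] := f_onto a le_a; have [b' fb] := f_onto b le_b.
have le_ab' : (a' <= b')%N by move: le_ab; rewrite -fa -fb leq_add2l.
have /upper_entries_indepE indep := genQ _ (ex_intro _ P (ex_intro _ f
   (And3 Punit f_incr erefl))).
(* d gives the coefficients of a quadric v of V whose restriction is y_a y_b,
   up to a factor 2. *)
have [d dE] := indep_dual_family indep (exist _ (a', b') le_ab').
pose v := \sum_k d k *: tnth Q k.
have Vv : v \in V.
  by rewrite -defV; apply: rpred_sum => k _; apply/rpredZ/memv_span/mem_tnth.
have vE (i j : 'I_q.+1) : (i <= j)%N ->
  (P *m quad_mx v *m P^T) (f i) (f j) = ((i == a') && (j == b'))%:R.
  move=> le_ij; have := dE (exist _ (i, j) le_ij).
  rewrite -val_eqE /= xpair_eqE => <-.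
  by rewrite /v quad_mx_congr_sum.
apply: (@ideal_isolate _ _ char_neq2 J _ v _ a b idJ (J_V Vv)
          (homog2_coordsE PT char_neq2 (dhomog_is_dhomog v))).
- by rewrite -fa -fb vE // !eqxx scale1r.
- by rewrite quad_mx_congr_sym -fa -fb vE // !eqxx scale1r mulrC.
move=> i j ne_ab ne_ba.
have [ij|] := boolP ((i < n - q)%N || (j < n - q)%N).
  by apply: ideal_scale => //; apply: Jy.
rewrite negb_or -!leqNgt => /andP[/f_onto[i' fi] /f_onto[j' fj]].
suff -> : (P *m quad_mx v *m P^T) i j = 0 by rewrite scale0r; case: idJ.
rewrite -fi -fj; case: (leqP i' j') => [le_ij|/ltnW le_ji].
  rewrite vE //; case: andP => // -[/eqP ei /eqP ej].
  by rewrite -fi -fj ei ej fa fb eqxx in ne_ab.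
rewrite quad_mx_congr_sym vE //; case: andP => // -[/eqP ej /eqP ei].
by rewrite -fi -fj ei ej fa fb eqxx in ne_ba.
Qed.

End Sufficiency.

(** * The inclusion gives genericity *)

Lemma lform_irrelevant (K : fieldType) (n : nat) (u : 'rV[K]_n) :
  irrelevant_ideal (lform u).
Proof.
have idm := ideal_gen_is_ideal (fun f => exists i : 'I_n, f = 'X_i).
apply: ideal_sum => [|i _]; first exact: idm.
apply: ideal_scale; first exact: idm.
by apply: ideal_gen_mem; exists i.
Qed.

(** The forms [l] to use are the coordinates outside the chosen rows [f], and
    the functional [phi] attached to a relation [c] vanishes on the resulting
    ideal but reads off each coefficient of [c] on some product of two
    coordinates. *)
Lemma contains_sq_generic (K : fieldType) (n m q : nat)
    (char_neq2 : 2%:R != 0 :> K) (le_q_n : (q <= n)%N)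
    (V : {vspace dhomog n.+1 K 2}) (Q : m.-tuple (dhomog n.+1 K 2))
    (defV : <<Q>>%VS = V) :
  (forall l : (n - q).-tuple (dhomog n.+1 K 1), free l ->
     forall f : {mpoly K[n.+1]},
       ideal_mul (@irrelevant_ideal K n.+1) (@irrelevant_ideal K n.+1) f ->
       ideal_add (form_ideal (mem V)) (form_ideal (mem l)) f) ->
  sym_generic q (repr_mx Q).
Proof.
move=> sqJ _ [P [f [Punit f_incr ->]]]; apply/upper_entries_indepE => c c0.
pose T := (invmx P)^T.
have TP : T *m P^T = 1%:M by rewrite -trmx_mul mulmxV // trmx1.
have f_inj : injective f.
  move=> i j fij; apply: val_inj; case: (ltngtP i j) => // /f_incr;
  by rewrite fij ltnn.
have card_f : (n - q)%N = #|[predC codom f]|.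
  have := cardC (mem (codom f)); rewrite card_codom // !card_ord.
  rewrite -[#|predC _|]/#|[predC codom f]|; lia.
pose e i : 'I_n.+1 := enum_val (cast_ord card_f i).
have e_inj : injective e.
  by apply: inj_comp (@cast_ord_inj _ _ _); apply: enum_val_inj.
have ef i a : e i != f a.
  have := enum_valP (cast_ord card_f i); rewrite inE /=.
  by apply: contraNneq; rewrite -/(e i) => ->; apply: codom_f.
pose l := [tuple DHomog (lform_homog (row (e i) T)) | i < n - q].
have free_l : free l.
  have lE (i : 'I_(n - q)) : mpoly_of_dhomog l`_i = lform (row (e i) T).
    by rewrite -tnth_nth tnth_mktuple.
  apply/freeP=> d d0 i.
  have rows0 : \sum_j d j *: row (e j) T = 0.
    transitivity (grad0 (mpoly_of_dhomog (\sum_j d j *: l`_j))).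
      rewrite !linear_sum; apply: eq_bigr => j _.
      by rewrite -{1}(grad0_lform (row (e j) T)) -lE -!linearZ.
    by rewrite d0 !linear0.
  have /rowP/(_ (e i)) : \sum_j d j *: delta_mx 0 (e j) = 0 :> 'rV[K]_n.+1.
    transitivity ((\sum_j d j *: row (e j) T) *m P^T); last by rewrite rows0 mul0mx.
    rewrite mulmx_suml; apply: eq_bigr => j _.
    by rewrite -scalemxAl (row_dual TP).
  rewrite summxE (bigD1 i) //= !mxE !eqxx mulr1 big1 ?addr0 // => j ne_ji.
  by rewrite !mxE (inj_eq e_inj) eq_sym (negPf ne_ji) andbF mulr0.
have c0V v : v \in V ->
    \sum_p c p * (P *m quad_mx v *m P^T) (f (val p).1) (f (val p).2) = 0.
  rewrite -defV => /coord_span def_v.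
  have {def_v} -> : v = \sum_k coord Q k v *: tnth Q k.
    by rewrite {1}def_v; apply: eq_bigr => k _; rewrite (tnth_nth 0).
  under eq_bigr do rewrite quad_mx_congr_sum mulr_sumr.
  rewrite exchange_big big1 // => k _.
  under eq_bigr do rewrite mulrCA.
  by rewrite -mulr_sumr c0 mulr0.
(* The Hessian at the origin of an element of V is twice its matrix, so that
   phi vanishes on V by c0V. *)
pose phi g := \sum_p c p * (P *m hess0 g *m P^T) (f (val p).1) (f (val p).2).
have phiD g h : phi (g + h) = phi g + phi h.
  rewrite -big_split; apply: eq_bigr => p _ /=.
  by rewrite linearD /= mulmxDr mulmxDl [(_ + _ : 'M_(_, _)) _ _]mxE mulrDr.
have phi0 : phi 0 = 0 by apply: (addrI (phi 0)); rewrite -phiD !addr0.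
have phi_gen G g :
    (forall a h, G h -> phi (a * h) = 0) -> ideal_gen G g -> phi g = 0.
  move=> phiG; apply: (ideal_gen_ind (S := fun g => phi g = 0)) => // a b pa pb.
  by rewrite phiD pa pb addr0.
have phi_J g : ideal_add (form_ideal (mem V)) (form_ideal (mem l)) g -> phi g = 0.
  case=> a [b [Va lb ->]]; rewrite phiD.
  rewrite (phi_gen _ _ _ Va) => [|h _ [v Vv ->]].
    rewrite (phi_gen _ _ _ lb) ?addr0 // => h _ [_ /tnthP[i ->] ->].
    rewrite tnth_mktuple /=; apply: big1 => p _.
    by rewrite (hess0M_coords TP) ?mulr0.
  rewrite -[RHS](mulr0 (val0 h *+ 2)) -(c0V v Vv) mulr_sumr; apply: eq_bigr => p _.
  rewrite (hess0M_homog2 char_neq2); last exact: dhomog_is_dhomog.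
  by rewrite -scalemxAr -scalemxAl mxE mulrCA.
case=> -[a b] /= le_ab.
have /phi_J : ideal_add (form_ideal (mem V)) (form_ideal (mem l))
   (lform (row (f a) T) * lform (row (f b) T)).
  apply: sqJ => //; apply: ideal_gen_mem.
  exists (lform (row (f a) T)), (lform (row (f b) T)).
  by split=> //; apply: lform_irrelevant.
rewrite /phi (hess0_coordsM TP) (bigD1 (exist _ (a, b) le_ab)) //= big1 ?addr0.
  rewrite !mxE !eqxx !(inj_eq f_inj) => /eqP; rewrite mulf_eq0 => /orP[/eqP //|].
  rewrite [b == a]eq_sym; case: (a == b); rewrite /= ?addr0 ?oner_eq0 //.
  by rewrite -natrD (negPf char_neq2).
case=> -[i j] /= le_ij; rewrite -val_eqE /= xpair_eqE !mxE !(inj_eq f_inj).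
move=> ne_ij; rewrite (negPf ne_ij); case: andP => [[/eqP ib /eqP ja]|_]; last first.
  by rewrite addr0 mulr0.
(* Both pairs are ordered, so (i, j) = (b, a) forces a = b, hence (i, j) = (a, b). *)
case/negP: ne_ij; rewrite ib ja eq_sym andbb; apply/eqP/val_inj/eqP.
by rewrite eqn_leq le_ab -ib -ja.
Qed.

Theorem proposition6p2 (K : closedFieldType) (charK : 2%N \notin [pchar K])
    (n m q : nat) (le_q_n : (q <= n)%N)
    (V : {vspace dhomog n.+1 K 2}) (dimV : (\dim V)%VS = m)
    (Q : m.-tuple (dhomog n.+1 K 2)) (basisQ : basis_of V Q) :
  (forall l : (n - q).-tuple (dhomog n.+1 K 1), free l ->
     forall f : {mpoly K[n.+1]},
       ideal_mul (@irrelevant_ideal K n.+1) (@irrelevant_ideal K n.+1) f ->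
       ideal_add (form_ideal (mem V)) (form_ideal (mem l)) f)
  <-> sym_generic q (repr_mx Q).
Proof.
have char_neq2 : 2%:R != 0 :> K by apply: contra charK => /= two0; rewrite inE.
have defV := span_basis basisQ.
split=> [|genQ l free_l f]; first exact: contains_sq_generic defV.
exact: (generic_contains_sq char_neq2 le_q_n defV free_l genQ).
Qed.
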